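(* Let $n=1$ and let $m\ge 1$ be odd. Then any local solution of the ordinary differential equation $-u^{(2m)}=e^u$ (i.e. $(-\Delta)^m u=e^u$ in dimension one) is global, i.e. it extends to a solution on all of $\mathbb{R}$. Moreover, if $m=1$ then any solution of $-u''=e^u$ in $\mathbb{R}$ is symmetric with respect to some point $x_0\in\mathbb{R}$. On the other hand, if $m\ge 3$, the equation $-u^{(2m)}=e^u$ in $\mathbb{R}$ admits solutions which are not symmetric with respect to any point $x_0\in\mathbb{R}$.
   Context: A function $u:\mathbb{R}\to\mathbb{R}$ is symmetric with respect to $x_0$ if $u(2x_0-x)=u(x)$ for all $x\in\mathbb{R}$. Solutions are classical. *)

(* Defs.v *)
From Stdlib Require Import Reals.
From Coquelicot Require Import Coquelicot.
Local Open Scope R_scope.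

(* [u] is of class C^n on the open interval (a, b). Coquelicot's [ex_derive_n]
   speaks about the order [k] alone ([Derive] is a total operator), so the
   existence of every order up to [n] is required. Only the values of [u] on
   (a, b) matter. *)
Definition class_C_on (n : nat) (a b : Rbar) (u : R -> R) : Prop :=
  forall x : R, Rbar_lt a x -> Rbar_lt x b ->
    (forall k : nat, (k <= n)%nat -> ex_derive_n u k x) /\
    continuous (Derive_n u n) x.

(* For odd [m], -u^(2m) = e^u is the one-dimensional (-Delta)^m u = e^u. *)
Definition solution_on (m : nat) (a b : Rbar) (u : R -> R) : Prop :=
  class_C_on (2 * m) a b u /\
  forall x : R, Rbar_lt a x -> Rbar_lt x b ->
    - Derive_n u (2 * m) x = exp (u x).

Definition global_solution (m : nat) (u : R -> R) : Prop :=
  solution_on m m_infty p_infty u.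

Definition symmetric_about (u : R -> R) (x0 : R) : Prop :=
  forall x : R, u (2 * x0 - x) = u x.

(* Main.v *)
Require Import Defs.
From Stdlib Require Import Reals Lra Lia.
From Coquelicot Require Import Coquelicot.
Local Open Scope R_scope.

(** Global existence comes for free from the sign of the nonlinearity and the even order. Fix a
    centre [c] and initial data, and let [P] be the polynomial of degree less
    than [2m] with these data. A function with vanishing data at [c] and
    nonpositive derivative of even order [2m] is nonpositive on both sides of
    [c] ([even_chain_nonpos]), so every Picard iterate for [u^(2m) = - exp u]
    stays below [P]. On the half-line below a local bound of [P] the exponential
    is Lipschitz, so no blow-up has to be ruled out: the iteration converges
    locally uniformly on the whole line and its limit is a global solution with
    the prescribed data ([global_chain_exists]).

    Convergence on an interval of arbitrary length is obtained in a single step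
    with the weight [cosh (l * (x - c))]: each integration from [c] gains a
    factor [1 / l] against it ([chain_cosh_bound]), so for [l] large in terms of
    the Lipschitz constant a Picard step halves weighted distances
    ([picard_step_halves]). The same contraction gives uniqueness
    ([chain_unique]), and a local solution therefore agrees with the global one
    that has the same data at an interior point.

    For [m = 1], a solution is concave, and its derivative must vanish
    somewhere: if [u] were increasing on a half-line on which [u'' <= - exp (u 0)],
    the derivative would decrease at least linearly and change sign. Reflecting
    about a zero [x0] of [u'] preserves the equation and the data at [x0], so
    uniqueness gives the symmetry.

    For larger [m], the solution with [u'(0) = 1] and all other data zero has no
    centre of symmetry. At such a centre all derivatives of odd order vanish;
    the one of order [2m - 1] is strictly decreasing, as its derivative is
    [- exp u], so it vanishes only at [0], where [u'] does not vanish. *)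

(** * Chains of derivatives and monotonicity *)

(** Carrying the derivatives as a family of functions avoids the total operator [Derive_n], and lets
    induction on the order drop the first member. *)
Definition derivative_chain (n : nat) (r1 r2 : R) (h : nat -> R -> R) : Prop :=
  forall (k : nat) (x : R), (k < n)%nat -> r1 <= x <= r2 ->
    is_derive (h k) x (h (S k) x).

Lemma is_derive_continuity_pt (f : R -> R) (x l : R) :
  is_derive f x l -> continuity_pt f x.
Proof.
  intros Hf. apply derivable_continuous_pt. exists l. now apply is_derive_Reals.
Qed.

Lemma derive_nonneg_le (f df : R -> R) (a b : R) :
  a <= b ->
  (forall x, a <= x <= b -> is_derive f x (df x)) ->
  (forall x, a <= x <= b -> 0 <= df x) ->
  f a <= f b.
Proof.
  intros Hab Hd Hpos.
  destruct (MVT_gen f a b df) as [z [Hz Heq]];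
    rewrite ?Rmin_left, ?Rmax_right in * by lra.
  - intros x Hx. apply Hd; lra.
  - intros x Hx. apply is_derive_continuity_pt with (df x). now apply Hd.
  - assert (0 <= df z * (b - a)) by (apply Rmult_le_pos; [now apply Hpos | lra]).
    lra.
Qed.

Lemma derive_nonpos_ge (f df : R -> R) (a b : R) :
  a <= b ->
  (forall x, a <= x <= b -> is_derive f x (df x)) ->
  (forall x, a <= x <= b -> df x <= 0) ->
  f b <= f a.
Proof.
  intros Hab Hd Hneg.
  assert (- f a <= - f b); [| lra].
  apply (derive_nonneg_le (fun x => - f x) (fun x => - df x)); auto.
  - intros x Hx. apply (is_derive_opp f). now apply Hd.
  - intros x Hx. specialize (Hneg x Hx). lra.
Qed.

(** * Bounds in the weight cosh *)

Lemma cosh_ge_1 (y : R) : 1 <= cosh y.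
Proof.
  unfold cosh. pose proof (exp_ineq1_le y). pose proof (exp_ineq1_le (- y)). lra.
Qed.

Lemma Rabs_sinh_le_cosh (y : R) : Rabs (sinh y) <= cosh y.
Proof.
  unfold sinh, cosh. pose proof (exp_pos y). pose proof (exp_pos (- y)).
  apply Rabs_le. lra.
Qed.

(** Comparison of [h] with the primitive [A / l * sinh (l * (x - c))] of the
    bound; it is [cosh] and not [sinh] that reappears on the right, so that the
    estimate can be iterated, and the even weight treats both sides of [c] alike. *)
Lemma integrate_cosh_bound (c r1 r2 l A : R) (h dh : R -> R) :
  r1 <= c <= r2 -> 0 < l -> h c = 0 ->
  (forall x, r1 <= x <= r2 -> is_derive h x (dh x)) ->
  (forall x, r1 <= x <= r2 -> Rabs (dh x) <= A * cosh (l * (x - c))) ->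
  forall x, r1 <= x <= r2 -> Rabs (h x) <= A / l * cosh (l * (x - c)).
Proof.
  intros Hc Hl H0 Hd Hb x Hx.
  assert (HA : 0 <= A).
  { specialize (Hb c Hc). pose proof (Rabs_pos (dh c)).
    pose proof (cosh_ge_1 (l * (c - c))). nra. }
  assert (HAl : 0 <= A / l) by (apply Rdiv_le_0_compat; lra).
  set (g := fun t => A / l * sinh (l * (t - c))).
  assert (Hg : forall t, is_derive g t (A * cosh (l * (t - c)))).
  { intros t. unfold g, sinh, cosh. auto_derive; [easy |]. unfold Rminus. field. lra. }
  assert (Hgc : g c = 0).
  { unfold g. replace (l * (c - c)) with 0 by ring. rewrite sinh_0. ring. }
  assert (Habs : Rabs (h x) <= Rabs (g x)).
  { assert (Hplus : forall t, r1 <= t <= r2 ->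
      is_derive (fun s => g s + h s) t (A * cosh (l * (t - c)) + dh t)).
    { intros t Ht. apply (is_derive_plus g h); auto. }
    assert (Hminus : forall t, r1 <= t <= r2 ->
      is_derive (fun s => g s - h s) t (A * cosh (l * (t - c)) - dh t)).
    { intros t Ht. apply (is_derive_minus g h); auto. }
    assert (Hb' : forall t, r1 <= t <= r2 ->
      - (A * cosh (l * (t - c))) <= dh t <= A * cosh (l * (t - c))).
    { intros t Ht. apply Rabs_le_between. now apply Hb. }
    destruct (Rle_lt_dec c x) as [Hcx | Hxc].
    - assert (g c + h c <= g x + h x).
      { eapply (derive_nonneg_le (fun s => g s + h s)); [lra | |].
        - intros t Ht. apply Hplus; lra.
        - intros t Ht. simpl. specialize (Hb' t). lra. }
      assert (g c - h c <= g x - h x).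
      { eapply (derive_nonneg_le (fun s => g s - h s)); [lra | |].
        - intros t Ht. apply Hminus; lra.
        - intros t Ht. simpl. specialize (Hb' t). lra. }
      rewrite (Rabs_pos_eq (g x)) by lra. apply Rabs_le. lra.
    - assert (g x + h x <= g c + h c).
      { eapply (derive_nonneg_le (fun s => g s + h s)); [lra | |].
        - intros t Ht. apply Hplus; lra.
        - intros t Ht. simpl. specialize (Hb' t). lra. }
      assert (g x - h x <= g c - h c).
      { eapply (derive_nonneg_le (fun s => g s - h s)); [lra | |].
        - intros t Ht. apply Hminus; lra.
        - intros t Ht. simpl. specialize (Hb' t). lra. }
      rewrite (Rabs_left1 (g x)) by lra. apply Rabs_le. lra. }
  apply Rle_trans with (1 := Habs). unfold g.
  rewrite Rabs_mult, (Rabs_pos_eq (A / l)) by lra.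
  apply Rmult_le_compat_l; [lra | apply Rabs_sinh_le_cosh].
Qed.

Lemma derivative_chain_tail (n : nat) (r1 r2 : R) (h : nat -> R -> R) :
  derivative_chain (S n) r1 r2 h ->
  derivative_chain n r1 r2 (fun k => h (S k)).
Proof. intros H k x Hk Hx. apply H; [lia | easy]. Qed.

(** The gain [1 / l ^ n] is what makes the Picard map contract on an interval
    of any length. *)
Lemma chain_cosh_bound (n : nat) (c r1 r2 l A : R) (h : nat -> R -> R) :
  r1 <= c <= r2 -> 0 < l ->
  derivative_chain n r1 r2 h ->
  (forall k, (k < n)%nat -> h k c = 0) ->
  (forall x, r1 <= x <= r2 -> Rabs (h n x) <= A * cosh (l * (x - c))) ->
  forall x, r1 <= x <= r2 -> Rabs (h 0%nat x) <= A / l ^ n * cosh (l * (x - c)).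
Proof.
  intros Hc Hl. revert h.
  induction n as [| n IH]; intros h Hch H0 Hb x Hx.
  - simpl. replace (A / 1) with A by field. now apply Hb.
  - replace (A / l ^ S n) with (A / l ^ n / l)
      by (simpl; field; split; [apply pow_nonzero |]; lra).
    apply (integrate_cosh_bound c r1 r2 l (A / l ^ n) (h 0%nat) (h 1%nat)); auto.
    + apply H0; lia.
    + intros y Hy. apply Hch; [lia | easy].
    + apply (IH (fun k => h (S k))).
      * now apply derivative_chain_tail.
      * intros k Hk. apply H0; lia.
      * exact Hb.
Qed.

(** Integrating once from [c] flips the sign to the left of [c]; integrating
    twice restores it. This is where the even order of the equation enters. *)
Lemma even_chain_nonpos (p : nat) (c r1 r2 : R) (h : nat -> R -> R) :
  r1 <= c <= r2 ->
  derivative_chain (2 * p) r1 r2 h ->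
  (forall k, (k < 2 * p)%nat -> h k c = 0) ->
  (forall x, r1 <= x <= r2 -> h (2 * p)%nat x <= 0) ->
  forall x, r1 <= x <= r2 -> h 0%nat x <= 0.
Proof.
  intros Hc. revert h.
  induction p as [| p IH]; intros h Hch H0 Hneg; [exact Hneg |].
  replace (2 * S p)%nat with (S (S (2 * p))) in * by lia.
  assert (H2 : forall x, r1 <= x <= r2 -> h 2%nat x <= 0).
  { apply (IH (fun k => h (S (S k)))).
    - apply (derivative_chain_tail _ _ _ (fun k => h (S k))).
      now apply derivative_chain_tail.
    - intros k Hk. apply H0; lia.
    - exact Hneg. }
  assert (d0 : forall x, r1 <= x <= r2 -> is_derive (h 0%nat) x (h 1%nat x))
    by (intros; apply Hch; [lia | easy]).
  assert (d1 : forall x, r1 <= x <= r2 -> is_derive (h 1%nat) x (h 2%nat x))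
    by (intros; apply Hch; [lia | easy]).
  assert (z0 : h 0%nat c = 0) by (apply H0; lia).
  assert (z1 : h 1%nat c = 0) by (apply H0; lia).
  intros x Hx. rewrite <- z0.
  destruct (Rle_lt_dec c x) as [Hcx | Hxc].
  - apply (derive_nonpos_ge (h 0%nat) (h 1%nat)); [easy | |].
    + intros t Ht. apply d0; lra.
    + intros t Ht. rewrite <- z1.
      apply (derive_nonpos_ge (h 1%nat) (h 2%nat)); [lra | |];
        intros s Hs; [apply d1 | apply H2]; lra.
  - apply (derive_nonneg_le (h 0%nat) (h 1%nat)); [lra | |].
    + intros t Ht. apply d0; lra.
    + intros t Ht. rewrite <- z1.
      apply (derive_nonpos_ge (h 1%nat) (h 2%nat)); [lra | |];
        intros s Hs; [apply d1 | apply H2]; lra.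
Qed.

(** * The contraction and uniqueness *)

Lemma exp_lipschitz (M p q : R) :
  p <= M -> q <= M -> Rabs (exp p - exp q) <= exp M * Rabs (p - q).
Proof.
  assert (Hle : forall s t, s <= t -> t <= M ->
            Rabs (exp s - exp t) <= exp M * Rabs (s - t)).
  { intros s t Hst HtM.
    assert (exp t <= exp M) by (destruct HtM as [HtM | ->]; [left; now apply exp_increasing | lra]).
    pose proof (exp_ineq1_le (s - t)). pose proof (exp_pos t).
    assert (exp s = exp t * exp (s - t)) by (rewrite <- exp_plus; f_equal; ring).
    assert (exp s <= exp t) by (destruct Hst as [Hst | ->]; [left; now apply exp_increasing | lra]).
    rewrite !Rabs_left1 by lra. nra. }
  intros Hp Hq. destruct (Rle_lt_dec p q) as [H | H].
  - now apply Hle.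
  - rewrite (Rabs_minus_sym (exp p)), (Rabs_minus_sym p). apply Hle; lra.
Qed.

(** The Picard map sends [p] to the [u 0] with fixed data and [n]-th derivative
    [- exp p]. Below the bound [M] the exponential has Lipschitz constant [exp M],
    and [l = 1 + 2 * exp M] satisfies both [1 <= l] and [exp M / l <= 1 / 2]; the
    first turns the gain [1 / l ^ n] into at most [1 / l]. *)
Lemma picard_step_halves (n : nat) (c r1 r2 M A : R) (u v : nat -> R -> R) (p q : R -> R) :
  (1 <= n)%nat -> r1 <= c <= r2 ->
  derivative_chain n r1 r2 u -> derivative_chain n r1 r2 v ->
  (forall k, (k < n)%nat -> u k c = v k c) ->
  (forall x, r1 <= x <= r2 -> u n x = - exp (p x)) ->
  (forall x, r1 <= x <= r2 -> v n x = - exp (q x)) ->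
  (forall x, r1 <= x <= r2 -> p x <= M) ->
  (forall x, r1 <= x <= r2 -> q x <= M) ->
  (forall x, r1 <= x <= r2 ->
     Rabs (p x - q x) <= A * cosh ((1 + 2 * exp M) * (x - c))) ->
  forall x, r1 <= x <= r2 ->
    Rabs (u 0%nat x - v 0%nat x) <= A / 2 * cosh ((1 + 2 * exp M) * (x - c)).
Proof.
  intros Hn Hc Hu Hv Hdata Hun Hvn Hp Hq Hpq x Hx.
  set (l := 1 + 2 * exp M) in *.
  assert (HM := exp_pos M).
  assert (HA : 0 <= A).
  { specialize (Hpq c Hc). pose proof (Rabs_pos (p c - q c)).
    pose proof (cosh_ge_1 (l * (c - c))). nra. }
  apply Rle_trans with (exp M * A / l ^ n * cosh (l * (x - c))).
  - apply (chain_cosh_bound n c r1 r2 l (exp M * A) (fun k y => u k y - v k y)); auto.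
    + unfold l; lra.
    + intros k y Hk Hy. apply (is_derive_minus (u k) (v k)); auto.
    + intros k Hk. rewrite Hdata by easy. ring.
    + intros y Hy. rewrite Hun, Hvn by easy.
      replace (- exp (p y) - - exp (q y)) with (- (exp (p y) - exp (q y))) by ring.
      rewrite Rabs_Ropp.
      apply Rle_trans with (1 := exp_lipschitz M _ _ (Hp y Hy) (Hq y Hy)).
      rewrite Rmult_assoc. apply Rmult_le_compat_l; [lra | auto].
  - apply Rmult_le_compat_r.
    + pose proof (cosh_ge_1 (l * (x - c))). lra.
    + assert (Hln : l <= l ^ n).
      { rewrite <- (pow_1 l) at 1. apply Rle_pow; [unfold l; lra | easy]. }
      apply Rle_div_l; [unfold l in *; lra |].
      unfold l in Hln at 1. nra.
Qed.

Lemma bounded_on_segment (f : R -> R) (a b : R) :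
  a <= b -> (forall x, a <= x <= b -> continuity_pt f x) ->
  exists M, forall x, a <= x <= b -> Rabs (f x) <= M.
Proof.
  intros Hab Hf.
  destruct (continuity_ab_maj (fun x => Rabs (f x)) a b Hab) as [z [Hz _]].
  - intros x Hx. apply (continuity_pt_comp f Rabs); [now apply Hf | apply Rcontinuity_abs].
  - now exists (Rabs (f z)).
Qed.

Lemma half_pow_lt (C eps : R) :
  0 < eps -> exists N : nat, forall n : nat, (N <= n)%nat -> C * (1 / 2) ^ n < eps.
Proof.
  intros Heps.
  assert (HC : 0 < Rabs C + 1) by (pose proof (Rabs_pos C); lra).
  destruct (pow_lt_1_zero (1 / 2)) with (y := eps / (Rabs C + 1)) as [N HN].
  - rewrite Rabs_pos_eq; lra.
  - now apply Rdiv_lt_0_compat.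
  - exists N. intros n Hn. specialize (HN n Hn).
    assert (Hp : 0 < (1 / 2) ^ n) by (apply pow_lt; lra).
    rewrite Rabs_pos_eq in HN by lra.
    apply Rlt_div_r in HN; [| easy].
    pose proof (Rle_abs C). nra.
Qed.

Lemma le_half_pow_eq0 (y C : R) : (forall j : nat, Rabs y <= C * (1 / 2) ^ j) -> y = 0.
Proof.
  intros H. destruct (Req_dec y 0) as [| Hy]; [easy |].
  destruct (half_pow_lt C (Rabs y)) as [N HN].
  - now apply Rabs_pos_lt.
  - specialize (HN N (le_n N)). specialize (H N). lra.
Qed.

(** A solution is a fixed point of the Picard map, so the weighted distance of
    two solutions is at most half of itself. *)
Lemma chain_unique (n : nat) (c r1 r2 : R) (u v : nat -> R -> R) :
  (1 <= n)%nat -> r1 <= c <= r2 ->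
  derivative_chain n r1 r2 u -> derivative_chain n r1 r2 v ->
  (forall k, (k < n)%nat -> u k c = v k c) ->
  (forall x, r1 <= x <= r2 -> u n x = - exp (u 0%nat x)) ->
  (forall x, r1 <= x <= r2 -> v n x = - exp (v 0%nat x)) ->
  forall x, r1 <= x <= r2 -> u 0%nat x = v 0%nat x.
Proof.
  intros Hn Hc Hu Hv Hdata Hun Hvn x Hx.
  destruct (bounded_on_segment (u 0%nat) r1 r2) as [Mu HMu]; [lra | |].
  { intros y Hy. eapply is_derive_continuity_pt, Hu; [lia | easy]. }
  destruct (bounded_on_segment (v 0%nat) r1 r2) as [Mv HMv]; [lra | |].
  { intros y Hy. eapply is_derive_continuity_pt, Hv; [lia | easy]. }
  set (M := Mu + Mv).
  assert (Hbu : forall y, r1 <= y <= r2 -> u 0%nat y <= M).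
  { intros y Hy. specialize (HMu y Hy). specialize (HMv y Hy).
    pose proof (Rle_abs (u 0%nat y)). pose proof (Rabs_pos (v 0%nat y)). unfold M. lra. }
  assert (Hbv : forall y, r1 <= y <= r2 -> v 0%nat y <= M).
  { intros y Hy. specialize (HMu y Hy). specialize (HMv y Hy).
    pose proof (Rle_abs (v 0%nat y)). pose proof (Rabs_pos (u 0%nat y)). unfold M. lra. }
  assert (Hj : forall (j : nat) y, r1 <= y <= r2 ->
    Rabs (u 0%nat y - v 0%nat y) <= M * (1 / 2) ^ j * cosh ((1 + 2 * exp M) * (y - c))).
  { induction j as [| j IH]; intros y Hy.
    - pose proof (cosh_ge_1 ((1 + 2 * exp M) * (y - c))).
      specialize (HMu y Hy). specialize (HMv y Hy).
      pose proof (Rabs_pos (v 0%nat y)). pose proof (Rabs_pos (u 0%nat y)).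
      apply Rle_trans with M.
      + apply Rle_trans with (1 := Rabs_triang _ _). rewrite Rabs_Ropp. unfold M. lra.
      + simpl. assert (0 <= M) by (unfold M; lra). nra.
    - replace (M * (1 / 2) ^ S j) with (M * (1 / 2) ^ j / 2) by (simpl; field).
      now apply (picard_step_halves n c r1 r2 M _ u v (u 0%nat) (v 0%nat)). }
  apply Rminus_diag_uniq.
  apply le_half_pow_eq0 with (M * cosh ((1 + 2 * exp M) * (x - c))).
  intros j. specialize (Hj j x Hx). lra.
Qed.

(** * Global existence by Picard iteration *)

(** [jet c n d f k] is the [k]-th derivative of the function whose derivatives
    of order [k < n] take the values [d k] at [c] and whose [n]-th derivative is
    [f]. It is built by repeated integration from [c], which makes Taylor
    polynomials and the kernel [(x - t) ^ (n - 1)] unnecessary. *)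
Fixpoint jet (c : R) (n : nat) (d : nat -> R) (f : R -> R) (k : nat) : R -> R :=
  match n, k with
  | O, _ => f
  | S n', O => fun x => d 0%nat + RInt (jet c n' (fun i => d (S i)) f 0) c x
  | S n', S k' => jet c n' (fun i => d (S i)) f k'
  end.

Lemma jet_top (c : R) (n : nat) (d : nat -> R) (f : R -> R) : jet c n d f n = f.
Proof. revert d. induction n as [| n IH]; intros d; [easy | apply IH]. Qed.

Lemma jet_data (c : R) (n : nat) (d : nat -> R) (f : R -> R) (k : nat) :
  (k < n)%nat -> jet c n d f k c = d k.
Proof.
  revert d k. induction n as [| n IH]; intros d [| k] Hk; try lia; simpl.
  - rewrite RInt_point. apply Rplus_0_r.
  - apply (IH (fun i => d (S i))). lia.
Qed.

(** Induction on [n]: the integrand of the outermost primitive is continuous,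
    being [f] itself or differentiable by the induction hypothesis. *)
Lemma jet_derive (c : R) (n : nat) (d : nat -> R) (f : R -> R) :
  (forall x, continuous f x) ->
  forall (k : nat) (x : R), (k < n)%nat ->
    is_derive (jet c n d f k) x (jet c n d f (S k) x).
Proof.
  intros Hf. revert d.
  induction n as [| n IH]; intros d [| k] x Hk; try lia; simpl.
  - assert (Hcont : forall y, continuous (jet c n (fun i => d (S i)) f 0) y).
    { intros y. destruct n as [| n']; [apply Hf |].
      apply (ex_derive_continuous (K := R_AbsRing) (V := R_NormedModule)).
      eexists. apply IH. lia. }
    replace (jet c n (fun i => d (S i)) f 0 x)
      with (plus 0 (jet c n (fun i => d (S i)) f 0 x)) by apply Rplus_0_l.
    apply (is_derive_plus (fun _ => d 0%nat)).
    + exact (is_derive_const (K := R_AbsRing) (V := R_NormedModule) (d 0%nat) x).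
    + apply (is_derive_RInt _ _ c x); [| apply Hcont].
      apply filter_forall. intros y. apply (RInt_correct (V := R_CompleteNormedModule)).
      apply (ex_RInt_continuous (V := R_CompleteNormedModule)). intros z _. apply Hcont.
  - apply (IH (fun i => d (S i))). lia.
Qed.

Lemma jet_continuous (c : R) (n : nat) (d : nat -> R) (f : R -> R) (x : R) :
  (1 <= n)%nat -> (forall y, continuous f y) -> continuous (jet c n d f 0) x.
Proof.
  intros Hn Hf. apply (ex_derive_continuous (K := R_AbsRing) (V := R_NormedModule)).
  eexists. apply jet_derive; [easy | lia].
Qed.

Lemma jet_chain (c : R) (n : nat) (d : nat -> R) (f : R -> R) (r1 r2 : R) :
  (forall x, continuous f x) -> derivative_chain n r1 r2 (jet c n d f).
Proof. intros Hf k x Hk _. now apply jet_derive. Qed.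

(** The iteration starts at the polynomial with data [d], i.e. at the solution
    of [u^(n) = 0], because this polynomial is an upper barrier for all iterates. *)
Fixpoint picard (c : R) (n : nat) (d : nat -> R) (j : nat) : R -> R :=
  match j with
  | O => jet c n d (fun _ => 0) 0
  | S j' => jet c n d (fun x => - exp (picard c n d j' x)) 0
  end.

Lemma continuous_opp_exp (f : R -> R) (x : R) :
  continuous f x -> continuous (fun y => - exp (f y)) x.
Proof.
  intros Hf. apply (continuous_opp (fun y => exp (f y))).
  apply (continuous_comp f exp); [easy | apply continuous_exp].
Qed.

Lemma picard_continuous (c : R) (n : nat) (d : nat -> R) (j : nat) (x : R) :
  (1 <= n)%nat -> continuous (picard c n d j) x.
Proof.
  intros Hn. revert x. induction j as [| j IH]; intros x; simpl.
  - apply jet_continuous; [easy | intros; apply continuous_const].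
  - apply jet_continuous; [easy |]. intros y. now apply continuous_opp_exp.
Qed.

(** The difference has zero data at [c] and derivative [- exp (...) < 0] of even
    order. This one-sided bound replaces any a priori estimate, since the
    exponential is Lipschitz on half-lines bounded above. *)
Lemma picard_le_polynomial (c : R) (p : nat) (d : nat -> R) (j : nat) (x : R) :
  (1 <= p)%nat -> picard c (2 * p) d j x <= picard c (2 * p) d 0 x.
Proof.
  intros Hp. destruct j as [| j]; [lra |].
  set (r1 := Rmin c x). set (r2 := Rmax c x).
  assert (Hc : r1 <= c <= r2) by (split; [apply Rmin_l | apply Rmax_l]).
  assert (Hx : r1 <= x <= r2) by (split; [apply Rmin_r | apply Rmax_r]).
  set (f := fun y => - exp (picard c (2 * p) d j y)).
  assert (Hf : forall y, continuous f y).
  { intros y. apply continuous_opp_exp, picard_continuous. lia. }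
  set (h := fun k y => jet c (2 * p) d f k y - jet c (2 * p) d (fun _ => 0) k y).
  apply Rminus_le. change (h 0%nat x <= 0).
  apply (even_chain_nonpos p c r1 r2 h); auto.
  - intros k y Hk Hy.
    apply (is_derive_minus (jet c (2 * p) d f k) (jet c (2 * p) d (fun _ => 0) k));
      apply jet_derive; auto.
    intros; apply continuous_const.
  - intros k Hk. unfold h. rewrite !jet_data by easy. ring.
  - intros y Hy. unfold h. rewrite !jet_top. unfold f.
    pose proof (exp_pos (picard c (2 * p) d j y)). lra.
Qed.

(** The constant absorbs the weight, which is bounded on the interval; the
    parameter of the weight depends on [L] through the bound [M] of the
    polynomial. *)
Lemma picard_cauchy (c : R) (p : nat) (d : nat -> R) (L : R) :
  (1 <= p)%nat -> 0 <= L ->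
  exists C, forall (j : nat) x, c - L <= x <= c + L ->
    Rabs (picard c (2 * p) d (S j) x - picard c (2 * p) d j x) <= C * (1 / 2) ^ j.
Proof.
  intros Hp HL.
  set (n := (2 * p)%nat). assert (Hn : (1 <= n)%nat) by (unfold n; lia).
  assert (Hcont : forall j x, continuous (picard c n d j) x)
    by (intros; now apply picard_continuous).
  assert (Hc : c - L <= c <= c + L) by lra.
  destruct (bounded_on_segment (picard c n d 0) (c - L) (c + L)) as [M HM]; [lra | |].
  { intros x _. apply continuity_pt_filterlim, Hcont. }
  destruct (bounded_on_segment (fun x => picard c n d 1 x - picard c n d 0 x)
              (c - L) (c + L)) as [C HC]; [lra | |].
  { intros x _. apply continuity_pt_filterlim.
    apply (continuous_minus (picard c n d 1) (picard c n d 0)); apply Hcont. }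
  destruct (bounded_on_segment (fun x => cosh ((1 + 2 * exp M) * (x - c)))
              (c - L) (c + L)) as [H HH]; [lra | |].
  { intros x _.
    assert (Hd : ex_derive (fun x => cosh ((1 + 2 * exp M) * (x - c))) x)
      by (unfold cosh; auto_derive; easy).
    destruct Hd as [l Hl]. now apply is_derive_continuity_pt with l. }
  assert (HC0 : 0 <= C)
    by (apply Rle_trans with (2 := HC c Hc); apply Rabs_pos).
  assert (Hb : forall j x, c - L <= x <= c + L -> picard c n d j x <= M).
  { intros j x Hx. apply Rle_trans with (picard c n d 0 x).
    - now apply picard_le_polynomial.
    - apply Rle_trans with (2 := HM x Hx). apply Rle_abs. }
  assert (Hj : forall (j : nat) x, c - L <= x <= c + L ->
    Rabs (picard c n d (S j) x - picard c n d j x)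
      <= C * (1 / 2) ^ j * cosh ((1 + 2 * exp M) * (x - c))).
  { induction j as [| j IH]; intros x Hx.
    - pose proof (cosh_ge_1 ((1 + 2 * exp M) * (x - c))).
      specialize (HC x Hx). simpl pow. nra.
    - replace (C * (1 / 2) ^ S j) with (C * (1 / 2) ^ j / 2) by (simpl; field).
      apply (picard_step_halves n c (c - L) (c + L) M (C * (1 / 2) ^ j)
               (jet c n d (fun y => - exp (picard c n d (S j) y)))
               (jet c n d (fun y => - exp (picard c n d j y)))
               (picard c n d (S j)) (picard c n d j)); auto.
      + apply jet_chain. intros y. now apply continuous_opp_exp.
      + apply jet_chain. intros y. now apply continuous_opp_exp.
      + intros k Hk. now rewrite !jet_data.
      + intros y _. now rewrite jet_top.
      + intros y _. now rewrite jet_top. }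
  exists (C * H). intros j x Hx. apply Rle_trans with (1 := Hj j x Hx).
  assert (0 < (1 / 2) ^ j) by (apply pow_lt; lra).
  specialize (HH x Hx). apply Rle_trans with (1 := Rle_abs _) in HH.
  replace (C * H * (1 / 2) ^ j) with (C * (1 / 2) ^ j * H) by ring.
  apply Rmult_le_compat_l; [| easy]. apply Rmult_le_pos; lra.
Qed.

Lemma geometric_limit (s : nat -> R) (C : R) :
  (forall j : nat, Rabs (s (S j) - s j) <= C * (1 / 2) ^ j) ->
  ex_finite_lim_seq s /\
  forall j : nat, Rabs (real (Lim_seq s) - s j) <= 2 * C * (1 / 2) ^ j.
Proof.
  intros Hs.
  assert (HC : 0 <= C).
  { specialize (Hs 0%nat). simpl in Hs. pose proof (Rabs_pos (s 1%nat - s 0%nat)). lra. }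
  assert (Htel : forall j q : nat, Rabs (s (q + j)%nat - s j) <= 2 * C * (1 / 2) ^ j).
  { intros j q.
    (* The factor [1 - (1 / 2) ^ q] is the exact geometric sum that makes the
       induction on [q] close. *)
    assert (Hq : Rabs (s (q + j)%nat - s j) <= 2 * C * (1 / 2) ^ j * (1 - (1 / 2) ^ q)).
    { induction q as [| q IH].
      - simpl. rewrite Rminus_diag, Rabs_R0. lra.
      - replace (s (S q + j)%nat - s j)
          with ((s (S (q + j)) - s (q + j)%nat) + (s (q + j)%nat - s j)) by (simpl; ring).
        apply Rle_trans with (1 := Rabs_triang _ _).
        specialize (Hs (q + j)%nat). rewrite pow_add in Hs. simpl pow.
        simpl pow in IH. nra. }
    assert (0 < (1 / 2) ^ q) by (apply pow_lt; lra).
    assert (0 < (1 / 2) ^ j) by (apply pow_lt; lra).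
    assert (0 <= 2 * C * (1 / 2) ^ j) by (apply Rmult_le_pos; lra).
    nra. }
  assert (Hex : ex_finite_lim_seq s).
  { apply ex_lim_seq_cauchy_corr. intros eps.
    destruct (half_pow_lt (4 * C) eps) as [N HN]; [apply cond_pos |].
    exists N. intros i j Hi Hj. specialize (HN N (le_n N)).
    pose proof (Htel N (i - N)%nat) as Hi'. pose proof (Htel N (j - N)%nat) as Hj'.
    replace (i - N + N)%nat with i in Hi' by lia.
    replace (j - N + N)%nat with j in Hj' by lia.
    replace (s i - s j) with ((s i - s N) - (s j - s N)) by ring.
    apply Rle_lt_trans with (1 := Rabs_triang _ _). rewrite Rabs_Ropp. lra. }
  split; [easy |]. intros j.
  assert (Hlim := Lim_seq_correct' s Hex).
  apply (is_lim_seq_incr_n s j) in Hlim.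
  assert (Hb : forall q, s j - 2 * C * (1 / 2) ^ j <= s (q + j)%nat
                         <= s j + 2 * C * (1 / 2) ^ j).
  { intros q. specialize (Htel j q). apply Rabs_le_between in Htel. lra. }
  apply Rabs_le. split.
  - assert (Hle : Rbar_le (s j - 2 * C * (1 / 2) ^ j) (real (Lim_seq s))).
    { apply (is_lim_seq_le (fun _ => s j - 2 * C * (1 / 2) ^ j)
               (fun q => s (q + j)%nat)); [apply Hb | apply is_lim_seq_const | easy]. }
    simpl in Hle. lra.
  - assert (Hle : Rbar_le (real (Lim_seq s)) (s j + 2 * C * (1 / 2) ^ j)).
    { apply (is_lim_seq_le (fun q => s (q + j)%nat)
               (fun _ => s j + 2 * C * (1 / 2) ^ j)); [apply Hb | easy | apply is_lim_seq_const]. }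
    simpl in Hle. lra.
Qed.

Lemma continuous_of_geometric_limit (s : nat -> R -> R) (U : R -> R) (c : R) :
  (forall j x, continuous (s j) x) ->
  (forall L, 0 <= L -> exists C, forall (j : nat) x, c - L <= x <= c + L ->
     Rabs (U x - s j x) <= C * (1 / 2) ^ j) ->
  forall x, continuous U x.
Proof.
  intros Hs HU x.
  assert (HL : 0 < Rabs (x - c) + 1) by (pose proof (Rabs_pos (x - c)); lra).
  set (L := mkposreal _ HL).
  destruct (HU L) as [C HC]; [simpl; lra |].
  apply continuity_pt_filterlim.
  apply (CVU_continuity s U c L).
  - intros eps Heps. destruct (half_pow_lt C eps Heps) as [N HN].
    exists N. intros j y Hj Hy.
    apply Rle_lt_trans with (2 := HN j Hj). apply HC.
    unfold Boule in Hy. apply Rabs_lt_between in Hy. lra.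
  - intros j y _. apply continuity_pt_filterlim, Hs.
  - unfold Boule. simpl. lra.
Qed.

(** The pointwise limit [U] of the iterates is continuous, so the Picard map
    can be applied to it. The image [u 0] equals [U], because by the contraction
    both are within [O(2^(-j))] of the iterate of index [S j]. *)
Lemma global_chain_exists (p : nat) (c : R) (d : nat -> R) :
  (1 <= p)%nat ->
  exists u : nat -> R -> R,
    (forall k x, (k < 2 * p)%nat -> is_derive (u k) x (u (S k) x)) /\
    (forall k, (k < 2 * p)%nat -> u k c = d k) /\
    (forall x, u (2 * p)%nat x = - exp (u 0%nat x)).
Proof.
  intros Hp.
  set (n := (2 * p)%nat). assert (Hn : (1 <= n)%nat) by (unfold n; lia).
  set (s := picard c n d).
  set (U := fun x => real (Lim_seq (fun j => s j x))).
  assert (Hcont : forall j x, continuous (s j) x)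
    by (intros; now apply picard_continuous).
  assert (HU : forall L, 0 <= L -> exists C, forall (j : nat) x, c - L <= x <= c + L ->
     Rabs (U x - s j x) <= C * (1 / 2) ^ j).
  { intros L HL. destruct (picard_cauchy c p d L Hp HL) as [C HC].
    exists (2 * C). intros j x Hx.
    apply (geometric_limit (fun j => s j x) C). intros i. now apply HC. }
  assert (HUc := continuous_of_geometric_limit s U c Hcont HU).
  set (u := jet c n d (fun x => - exp (U x))).
  assert (Hf : forall x, continuous (fun x => - exp (U x)) x)
    by (intros; now apply continuous_opp_exp).
  assert (HuU : forall x, u 0%nat x = U x).
  { intros x. set (L := Rabs (x - c)).
    assert (HL : 0 <= L) by apply Rabs_pos.
    assert (Hc : c - L <= c <= c + L) by lra.
    assert (Hx : c - L <= x <= c + L).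
    { assert (H : Rabs (x - c) <= L) by apply Rle_refl.
      apply Rabs_le_between in H. lra. }
    destruct (bounded_on_segment (s 0%nat) (c - L) (c + L)) as [M HM]; [lra | |].
    { intros y _. apply continuity_pt_filterlim, Hcont. }
    assert (Hsb : forall j y, c - L <= y <= c + L -> s j y <= M).
    { intros j y Hy. apply Rle_trans with (s 0%nat y).
      - now apply picard_le_polynomial.
      - apply Rle_trans with (2 := HM y Hy). apply Rle_abs. }
    destruct (HU L HL) as [C HC].
    assert (HC0 : 0 <= C).
    { specialize (HC 0%nat c Hc). simpl in HC.
      pose proof (Rabs_pos (U c - s 0%nat c)). lra. }
    (* The barrier passes to the limit of the iterates. *)
    assert (HUb : forall y, c - L <= y <= c + L -> U y <= M).
    { intros y Hy. apply Rnot_lt_le. intros Hlt.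
      destruct (half_pow_lt C (U y - M)) as [N HN]; [lra |].
      specialize (HN N (le_n N)). specialize (HC N y Hy). specialize (Hsb N y Hy).
      pose proof (Rle_abs (U y - s N y)). lra. }
    set (W := cosh ((1 + 2 * exp M) * (x - c))).
    assert (HW : 1 <= W) by apply cosh_ge_1.
    apply Rminus_diag_uniq. apply le_half_pow_eq0 with (C * W).
    intros j.
    assert (H1 : Rabs (u 0%nat x - s (S j) x) <= C * (1 / 2) ^ j / 2 * W).
    { apply (picard_step_halves n c (c - L) (c + L) M (C * (1 / 2) ^ j)
               u (jet c n d (fun y => - exp (s j y))) U (s j)); auto.
      - now apply jet_chain.
      - apply jet_chain. intros y. now apply continuous_opp_exp.
      - intros k Hk. unfold u. now rewrite !jet_data.
      - intros y _. unfold u. now rewrite jet_top.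
      - intros y _. now rewrite jet_top.
      - intros y Hy. apply Rle_trans with (1 := HC j y Hy).
        rewrite <- (Rmult_1_r (C * (1 / 2) ^ j)) at 1.
        apply Rmult_le_compat_l; [| apply cosh_ge_1].
        apply Rmult_le_pos; [easy | apply pow_le; lra]. }
    assert (H2 := HC (S j) x Hx).
    replace (u 0%nat x - U x) with ((u 0%nat x - s (S j) x) - (U x - s (S j) x)) by ring.
    apply Rle_trans with (1 := Rabs_triang _ _). rewrite Rabs_Ropp.
    assert (Hp' : 0 <= C * (1 / 2) ^ j) by (apply Rmult_le_pos; [easy | apply pow_le; lra]).
    simpl pow in H2. nra. }
  exists u. split; [| split].
  - intros k x Hk. now apply jet_derive.
  - intros k Hk. now apply jet_data.
  - intros x. unfold u at 1. rewrite jet_top. now rewrite HuU.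
Qed.

(** * Chains and classical solutions *)

Lemma global_chain_Derive_n (n : nat) (u : nat -> R -> R) :
  (forall k x, (k < n)%nat -> is_derive (u k) x (u (S k) x)) ->
  forall k x, (k <= n)%nat -> Derive_n (u 0%nat) k x = u k x.
Proof.
  intros Hu. induction k as [| k IH]; intros x Hk; [easy |].
  simpl. rewrite (Derive_ext _ (u k)) by (intros; apply IH; lia).
  apply is_derive_unique, Hu. lia.
Qed.

Lemma global_chain_solution (m : nat) (u : nat -> R -> R) :
  (1 <= m)%nat ->
  (forall k x, (k < 2 * m)%nat -> is_derive (u k) x (u (S k) x)) ->
  (forall x, u (2 * m)%nat x = - exp (u 0%nat x)) ->
  global_solution m (u 0%nat).
Proof.
  intros Hm Hu Heq.
  assert (HD := global_chain_Derive_n (2 * m) u Hu).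
  split; [intros x _ _; split |].
  - intros [| k] Hk; [easy |]. simpl.
    apply (ex_derive_ext (u k)).
    + intros y. symmetry. apply HD. lia.
    + eexists. apply Hu. lia.
  - apply (continuous_ext (fun y => - exp (u 0%nat y))).
    + intros y. now rewrite HD.
    + apply continuous_opp_exp.
      apply (ex_derive_continuous (K := R_AbsRing) (V := R_NormedModule)).
      eexists. apply Hu. lia.
  - intros x _ _. rewrite HD, Heq by easy. ring.
Qed.

Lemma solution_on_chain (m : nat) (a b : Rbar) (u : R -> R) (r1 r2 : R) :
  solution_on m a b u -> Rbar_lt a r1 -> Rbar_lt r2 b ->
  derivative_chain (2 * m) r1 r2 (Derive_n u) /\
  forall x, r1 <= x <= r2 -> Derive_n u (2 * m) x = - exp (u x).
Proof.
  intros [HC Heq] Ha Hb.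
  assert (Hin : forall x, r1 <= x <= r2 -> Rbar_lt a x /\ Rbar_lt x b).
  { intros x Hx. split.
    - apply Rbar_lt_le_trans with (1 := Ha). simpl. lra.
    - apply Rbar_le_lt_trans with (2 := Hb). simpl. lra. }
  split.
  - intros k x Hk Hx. destruct (Hin x Hx) as [Hax Hxb].
    apply Derive_correct. exact (proj1 (HC x Hax Hxb) (S k) Hk).
  - intros x Hx. destruct (Hin x Hx) as [Hax Hxb].
    rewrite <- (Heq x Hax Hxb). ring.
Qed.

Lemma global_solution_chain (m : nat) (u : R -> R) (r1 r2 : R) :
  global_solution m u ->
  derivative_chain (2 * m) r1 r2 (Derive_n u) /\
  forall x, r1 <= x <= r2 -> Derive_n u (2 * m) x = - exp (u x).
Proof. intros Hu. now apply (solution_on_chain m m_infty p_infty). Qed.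

Lemma Rbar_interval_point (a b : Rbar) :
  Rbar_lt a b -> exists x : R, Rbar_lt a x /\ Rbar_lt x b.
Proof.
  destruct a as [a | |], b as [b | |]; simpl; intros Hab; try easy.
  - exists ((a + b) / 2). simpl. lra.
  - exists (a + 1). simpl. lra.
  - exists (b - 1). simpl. lra.
  - now exists 0.
Qed.

(** The global solution takes its data from [u] at an interior point [c];
    uniqueness is applied on the segment between [c] and [x]. *)
Lemma local_solution_extends (m : nat) (a b : Rbar) (u : R -> R) :
  (1 <= m)%nat -> Rbar_lt a b -> solution_on m a b u ->
  exists U : R -> R, global_solution m U /\
    forall x : R, Rbar_lt a x -> Rbar_lt x b -> U x = u x.
Proof.
  intros Hm Hab Hu.
  destruct (Rbar_interval_point a b Hab) as [c [Hac Hcb]].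
  destruct (global_chain_exists m c (fun k => Derive_n u k c) Hm)
    as [v [Hv [Hdata Heq]]].
  exists (v 0%nat). split; [now apply global_chain_solution |].
  intros x Hax Hxb.
  assert (Ha : Rbar_lt a (Rmin c x)) by (unfold Rmin; destruct (Rle_dec c x); easy).
  assert (Hb : Rbar_lt (Rmax c x) b) by (unfold Rmax; destruct (Rle_dec c x); easy).
  destruct (solution_on_chain m a b u _ _ Hu Ha Hb) as [Hch Hue].
  apply (chain_unique (2 * m) c (Rmin c x) (Rmax c x) v (Derive_n u)); auto.
  - lia.
  - split; [apply Rmin_l | apply Rmax_l].
  - intros k y Hk _. now apply Hv.
  - split; [apply Rmin_r | apply Rmax_r].
Qed.

(** * Symmetry in the second-order case *)

(** The derivative [g] of [u] is nonincreasing. If [g 0 > 0] and [g] stayed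
    positive up to [x = g 0 / exp (u 0)], then [u] would exceed [u 0] on [[0, x]],
    hence [u'' <= - exp (u 0)] there and [g x <= 0]. The case [g 0 < 0] is the
    mirror image, with the same formula for [x], now negative. *)
Lemma second_order_critical_point (u : R -> R) :
  global_solution 1 u -> exists x0, Derive_n u 1 x0 = 0.
Proof.
  intros Hu.
  assert (Hd : forall k x, (k < 2)%nat -> is_derive (Derive_n u k) x (Derive_n u (S k) x)).
  { intros k x Hk. apply (global_solution_chain 1 u x x Hu); [easy | lra]. }
  assert (He : forall x, Derive_n u 2 x = - exp (u x)).
  { intros x. apply (global_solution_chain 1 u x x Hu). lra. }
  assert (Hd0 : forall x, is_derive u x (Derive_n u 1 x)) by (intros; apply (Hd 0%nat); lia).
  assert (Hd1 : forall x, is_derive (Derive_n u 1) x (Derive_n u 2 x)) by (intros; apply Hd; lia).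
  set (g := Derive_n u 1) in *.
  assert (He0 := exp_pos (u 0)).
  assert (Hmono : forall x y, x <= y -> g y <= g x).
  { intros x y Hxy. apply (derive_nonpos_ge g (Derive_n u 2)); auto.
    intros t _. rewrite He. pose proof (exp_pos (u t)). lra. }
  assert (Hslope : forall x y, x <= y -> (forall t, x <= t <= y -> u 0 <= u t) ->
    g y <= g x - exp (u 0) * (y - x)).
  { intros x y Hxy Ht.
    assert (g y + exp (u 0) * y <= g x + exp (u 0) * x); [| lra].
    apply (derive_nonpos_ge (fun t => g t + exp (u 0) * t)
             (fun t => Derive_n u 2 t + exp (u 0))); [easy | |].
    - intros t _. apply (is_derive_plus g (fun t => exp (u 0) * t)); [apply Hd1 |].
      auto_derive; [easy | ring].
    - intros t Hxt. rewrite He. specialize (Ht t Hxt).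
      assert (exp (u 0) <= exp (u t))
        by (destruct Ht as [Ht | ->]; [left; now apply exp_increasing | lra]).
      lra. }
  assert (Hpos : exists x, 0 <= g x).
  { destruct (Rle_lt_dec 0 (g 0)) as [H0 | H0]; [now exists 0 |].
    set (x := g 0 / exp (u 0)). exists x. apply Rnot_lt_le. intros Hx.
    assert (Hx0 : x <= 0).
    { unfold x. apply Rle_div_l; lra. }
    assert (Hs := Hslope x 0 Hx0).
    assert (Hxe : exp (u 0) * x = g 0) by (unfold x; field; lra).
    assert (g 0 <= g x - exp (u 0) * (0 - x)); [| lra].
    apply Hs. intros t Ht.
    apply (derive_nonpos_ge u g); [lra | auto |].
    intros r Hr. specialize (Hmono x r). lra. }
  assert (Hneg : exists x, g x <= 0).
  { destruct (Rle_lt_dec (g 0) 0) as [H0 | H0]; [now exists 0 |].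
    set (x := g 0 / exp (u 0)). exists x. apply Rnot_lt_le. intros Hx.
    assert (Hx0 : 0 <= x).
    { unfold x. apply Rdiv_le_0_compat; lra. }
    assert (Hs := Hslope 0 x Hx0).
    assert (Hxe : exp (u 0) * x = g 0) by (unfold x; field; lra).
    assert (g x <= g 0 - exp (u 0) * (x - 0)); [| lra].
    apply Hs. intros t Ht.
    apply (derive_nonneg_le u g); [lra | auto |].
    intros r Hr. specialize (Hmono r x). lra. }
  destruct Hpos as [x Hx], Hneg as [y Hy].
  destruct (IVT_gen g x y 0) as [z [_ Hz]].
  - intros t. apply (is_derive_continuity_pt g t _ (Hd1 t)).
  - rewrite Rmin_right, Rmax_left by lra. lra.
  - now exists z.
Qed.

Lemma is_derive_reflect (f : R -> R) (x0 x l : R) :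
  is_derive f (2 * x0 - x) l -> is_derive (fun y => f (2 * x0 - y)) x (- l).
Proof.
  intros Hf. replace (- l) with (scal (-1) l) by (unfold scal; simpl; unfold mult; simpl; ring).
  apply (is_derive_comp f (fun y => 2 * x0 - y)); [easy |].
  auto_derive; [easy | ring].
Qed.

(** The reflection of [u] about a critical point has the same data there, as
    only the sign of the first derivative could differ. *)
Lemma second_order_symmetric (u : R -> R) :
  global_solution 1 u -> exists x0, symmetric_about u x0.
Proof.
  intros Hu. destruct (second_order_critical_point u Hu) as [x0 H0].
  exists x0. intros x.
  assert (Hd : forall k x, (k < 2)%nat -> is_derive (Derive_n u k) x (Derive_n u (S k) x)).
  { intros k y Hk. apply (global_solution_chain 1 u y y Hu); [easy | lra]. }
  assert (He : forall x, Derive_n u 2 x = - exp (u x)).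
  { intros y. apply (global_solution_chain 1 u y y Hu). lra. }
  set (v := fun k y => (-1) ^ k * Derive_n u k (2 * x0 - y)).
  assert (Hv : v 0%nat x = Derive_n u 0 x); [| unfold v in Hv; simpl in Hv; lra].
  apply (chain_unique 2 x0 (Rmin x0 x) (Rmax x0 x) v (Derive_n u)).
  - lia.
  - split; [apply Rmin_l | apply Rmax_l].
  - intros k y Hk _. unfold v.
    replace ((-1) ^ S k * Derive_n u (S k) (2 * x0 - y))
      with ((-1) ^ k * (- Derive_n u (S k) (2 * x0 - y))) by (simpl; ring).
    apply (is_derive_scal (fun y => Derive_n u k (2 * x0 - y))).
    now apply is_derive_reflect, Hd.
  - intros k y Hk _. now apply Hd.
  - intros k Hk. unfold v. replace (2 * x0 - x0) with x0 by ring.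
    destruct k as [| [| k]]; [simpl; ring | rewrite H0; ring | lia].
  - intros y _. unfold v. rewrite He. simpl. rewrite !Rmult_1_l. ring.
  - intros y _. apply He.
  - split; [apply Rmin_r | apply Rmax_r].
Qed.

(** * Solutions without symmetry *)

(** Differentiating [u (2 * x0 - x) = u x] gives the sign [(-1) ^ k] at order
    [k]; at [x = x0] and [k] odd this reads [u k x0 = - u k x0]. *)
Lemma symmetric_odd_derivative (n : nat) (u : nat -> R -> R) (x0 : R) :
  (forall k x, (k < n)%nat -> is_derive (u k) x (u (S k) x)) ->
  symmetric_about (u 0%nat) x0 ->
  forall k, (k <= n)%nat -> Nat.Odd k -> u k x0 = 0.
Proof.
  intros Hu Hsym.
  assert (Hk : forall k x, (k <= n)%nat -> u k (2 * x0 - x) = (-1) ^ k * u k x).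
  { induction k as [| k IH]; intros x Hk; [rewrite Hsym; simpl; ring |].
    assert (H1 : is_derive (fun y => u k (2 * x0 - y)) x (- u (S k) (2 * x0 - x))).
    { apply is_derive_reflect, Hu. lia. }
    assert (H2 : is_derive (fun y => u k (2 * x0 - y)) x ((-1) ^ k * u (S k) x)).
    { apply (is_derive_ext (fun y => (-1) ^ k * u k y)).
      - intros y. symmetry. apply IH. lia.
      - apply is_derive_scal, Hu. lia. }
    apply is_derive_unique in H1. apply is_derive_unique in H2. simpl. lra. }
  intros k Hkn [q ->]. specialize (Hk (2 * q + 1)%nat x0 Hkn).
  replace (2 * x0 - x0) with x0 in Hk by ring.
  rewrite pow_add, pow_mult in Hk. replace ((-1) ^ 2) with 1 in Hk by ring.
  rewrite pow1 in Hk. lra.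
Qed.

(** The derivative of order [2 * m - 1] locates the only possible centre, and
    the first derivative excludes it; [2 <= m] makes these two orders distinct,
    so that their values at [0] can be prescribed independently. *)
Lemma asymmetric_solution_exists (m : nat) :
  (2 <= m)%nat ->
  exists u : R -> R, global_solution m u /\ ~ (exists x0 : R, symmetric_about u x0).
Proof.
  intros Hm.
  destruct (global_chain_exists m 0 (fun k => if Nat.eqb k 1 then 1 else 0))
    as [u [Hu [Hdata Heq]]]; [lia |].
  exists (u 0%nat). split; [apply global_chain_solution; auto; lia |].
  intros [x0 Hsym].
  assert (Hodd := symmetric_odd_derivative (2 * m) u x0 Hu Hsym).
  set (k := (2 * m - 1)%nat).
  assert (Hk0 : u k 0 = 0).
  { rewrite Hdata by (unfold k; lia).
    destruct (Nat.eqb_spec k 1) as [H | _]; [unfold k in H; lia | easy]. }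
  assert (Hkx : u k x0 = 0).
  { apply Hodd; [unfold k; lia |]. exists (m - 1)%nat. unfold k. lia. }
  assert (Hd : forall x, is_derive (u k) x (- exp (u 0%nat x))).
  { intros x. rewrite <- Heq. replace (2 * m)%nat with (S k) by (unfold k; lia).
    apply Hu. unfold k. lia. }
  assert (Hx0 : x0 = 0).
  { destruct (MVT_gen (u k) 0 x0 (fun x => - exp (u 0%nat x))) as [z [_ Hz]].
    - intros x _. apply Hd.
    - intros x _. apply (is_derive_continuity_pt _ _ _ (Hd x)).
    - rewrite Hk0, Hkx in Hz. pose proof (exp_pos (u 0%nat z)). nra. }
  assert (H1 : u 1%nat 0 = 0).
  { rewrite Hx0 in Hodd. apply Hodd; [lia |]. now exists 0%nat. }
  rewrite Hdata in H1 by lia. simpl in H1. lra.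
Qed.

Theorem theorem2p4 (m : nat) (hm : (1 <= m)%nat) (hodd : Nat.Odd m) :
  (forall (a b : Rbar) (u : R -> R), Rbar_lt a b -> solution_on m a b u ->
     exists U : R -> R, global_solution m U /\
       (forall x : R, Rbar_lt a x -> Rbar_lt x b -> U x = u x)) /\
  (m = 1%nat ->
     forall u : R -> R, global_solution m u ->
       exists x0 : R, symmetric_about u x0) /\
  ((3 <= m)%nat ->
     exists u : R -> R, global_solution m u /\
       ~ (exists x0 : R, symmetric_about u x0)).
Proof.
  split; [| split].
  - intros a b u. now apply local_solution_extends.
  - intros -> u. apply second_order_symmetric.
  - intros Hm. apply asymmetric_solution_exists. lia.
Qed.
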